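(* Let $A=(a_{ij})\in M_n(\mathbb{H})$, let $\gamma\in[0,1]$, and let $p,q\in(1,\infty)$ with $\frac1p+\frac1q=1$. Assume that $$\Re(a_{ii})+(n-1)^{\frac{1-\gamma}{q}}\,r_i(A)^{\gamma}\,\bigl(n_i^{(p)}(A)\bigr)^{1-\gamma}<0,\qquad 1\le i\le n.$$ Then the matrix $A$ is stable.
   Context: $\mathbb{H}$ is the skew field of real quaternions with its usual modulus $|\cdot|$; $\Re(a_0+a_1\mathbf{i}+a_2\mathbf{j}+a_3\mathbf{k})=a_0$. $M_n(\mathbb{H})$ is the set of $n\times n$ quaternionic matrices. A quaternion $\lambda$ is a right eigenvalue of $A$ if $Ax=x\lambda$ for some nonzero column vector $x\in\mathbb{H}^n$; $\Lambda_r(A)$ is the set of right eigenvalues. $A$ is stable if $\Lambda_r(A)\subset\mathbb{H}^-:=\{q\in\mathbb{H}:\Re(q)<0\}$. $r_i(A):=\sum_{j\ne i}|a_{ij}|$ and $n_i^{(p)}(A):=\bigl(\sum_{j\neq i}|a_{ij}|^p\bigr)^{1/p}$. Convention: $0^0=1$. *)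

(* Defs.v *)
From HB Require Import structures.
From mathcomp Require Import all_boot all_order all_algebra.
From mathcomp Require Import ring.
From mathcomp Require Import boolp classical_sets reals exp.

Set Implicit Arguments.
Unset Strict Implicit.
Unset Printing Implicit Defensive.

Import Order.TTheory GRing.Theory Num.Theory.

Local Open Scope ring_scope.
Local Open Scope classical_set_scope.

(* [Quat a b c d] is a + b i + c j + d k. *)
Record quat (R : Type) := Quat { qre : R; qim_i : R; qim_j : R; qim_k : R }.

Section QuatRing.
Variable R : realType.
Implicit Types x y z : quat R.

Definition quat_to_prod x : R * R * R * R :=
  (qre x, qim_i x, qim_j x, qim_k x).
Definition quat_of_prod (t : R * R * R * R) : quat R :=
  Quat t.1.1.1 t.1.1.2 t.1.2 t.2.

Lemma quat_to_prodK : cancel quat_to_prod quat_of_prod.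
Proof. by case. Qed.

HB.instance Definition _ := Choice.copy (quat R) (can_type quat_to_prodK).

Definition quat_zero : quat R := Quat 0 0 0 0.
Definition quat_one : quat R := Quat 1 0 0 0.
Definition quat_opp x := Quat (- qre x) (- qim_i x) (- qim_j x) (- qim_k x).
Definition quat_add x y :=
  Quat (qre x + qre y) (qim_i x + qim_i y) (qim_j x + qim_j y)
       (qim_k x + qim_k y).

(* i^2 = j^2 = k^2 = ijk = -1 *)
Definition quat_mul x y :=
  let: Quat a b c d := x in
  let: Quat a' b' c' d' := y in
  Quat (a * a' - b * b' - c * c' - d * d')
       (a * b' + b * a' + c * d' - d * c')
       (a * c' - b * d' + c * a' + d * b')
       (a * d' + b * c' - c * b' + d * a').

Lemma quat_addA : associative quat_add.
Proof.
by move=> [a b c d] [e f g h] [u v w z]; rewrite /quat_add /= !addrA.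
Qed.

Lemma quat_addC : commutative quat_add.
Proof.
move=> [a b c d] [e f g h]; rewrite /quat_add /=.
by congr Quat; rewrite addrC.
Qed.

Lemma quat_add0 : left_id quat_zero quat_add.
Proof. by move=> [a b c d]; rewrite /quat_add /= !add0r. Qed.

Lemma quat_addN : left_inverse quat_zero quat_opp quat_add.
Proof. by move=> [a b c d]; rewrite /quat_add /= !addNr. Qed.

Lemma quat_mulA : associative quat_mul.
Proof.
by move=> [a b c d] [e f g h] [u v w z]; rewrite /quat_mul; congr Quat; ring.
Qed.

Lemma quat_mul1l : left_id quat_one quat_mul.
Proof. by move=> [a b c d]; rewrite /quat_mul /=; congr Quat; ring. Qed.

Lemma quat_mul1r : right_id quat_one quat_mul.
Proof. by move=> [a b c d]; rewrite /quat_mul /=; congr Quat; ring. Qed.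

Lemma quat_mulDl : left_distributive quat_mul quat_add.
Proof.
move=> [a b c d] [e f g h] [u v w z]; rewrite /quat_mul /quat_add /=.
by congr Quat; ring.
Qed.

Lemma quat_mulDr : right_distributive quat_mul quat_add.
Proof.
move=> [a b c d] [e f g h] [u v w z]; rewrite /quat_mul /quat_add /=.
by congr Quat; ring.
Qed.

Lemma quat_one_neq0 : quat_one != quat_zero.
Proof. by apply/eqP => -[] /eqP; rewrite oner_eq0. Qed.

HB.instance Definition _ := GRing.isNzRing.Build (quat R)
  quat_addA quat_addC quat_add0 quat_addN quat_mulA quat_mul1l quat_mul1r
  quat_mulDl quat_mulDr quat_one_neq0.

Definition qmod x : R :=
  Num.sqrt (qre x ^+ 2 + qim_i x ^+ 2 + qim_j x ^+ 2 + qim_k x ^+ 2).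

End QuatRing.

Section QuatMatrix.
Variables (R : realType) (n : nat).
Implicit Types A : 'M[quat R]_n.

(* Scalars act on column vectors from the right; [*:] would act from the
   left. *)
Definition right_eigenvalues A : set (quat R) :=
  [set l | exists2 x : 'cV[quat R]_n,
             x != 0 & A *m x = \col_i (x i ord0 * l)].

Definition quat_stable A : Prop :=
  right_eigenvalues A `<=` [set q | qre q < 0].

Definition row_sum A (i : 'I_n) : R := \sum_(j < n | j != i) qmod (A i j).

Definition row_pnorm (p : R) A (i : 'I_n) : R :=
  powR (\sum_(j < n | j != i) powR (qmod (A i j)) p) p^-1.

End QuatMatrix.

(* Main.v *)
Require Import Defs.
From mathcomp Require Import all_boot all_order all_algebra.
From mathcomp Require Import ring lra.
From mathcomp Require Import reals exp.

Import Order.TTheory GRing.Theory Num.Theory.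

Local Open Scope ring_scope.

(** The statement reduces to a Gershgorin-type theorem: every right eigenvalue
    [l] satisfies [qre l <= qre (A i i) + row_sum A i] for some [i]
    ([right_eigenvalue_qre_le]).  To see this, take [i] for which the entry
    [x i] of an eigenvector has the largest modulus, multiply the [i]-th row of
    [A x = x l] on the right by the conjugate of [x i], and take real parts.
    The real part of a product of quaternions does not change when the factors
    are permuted cyclically, so [x i * l * conj (x i)] has real part
    [qre l * |x i|^2]: passing to the similar quaternion does not move the real
    part, which is why a bound on real parts (though not on the eigenvalue
    itself) survives noncommutativity.  The diagonal term contributes
    [qre (A i i) * |x i|^2] and the others at most [row_sum A i * |x i|^2].

    It remains to bound [row_sum A i] by the mixed quantity in the hypothesis.
    Hölder's inequality against the constant vector 1 ([sum_le_card_pnorm])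
    gives [r <= (n - 1) ^ (1/q) * N] for the row sum [r] and the [p]-norm [N];
    writing [r = r ^ gamma * r ^ (1 - gamma)] and applying Hölder to the second
    factor only gives the interpolated bound. *)

Section Quaternions.
Context {R : realType}.
Implicit Types x y z l : quat R.

Definition qconj x := Quat (qre x) (- qim_i x) (- qim_j x) (- qim_k x).

Lemma qre_sum (I : finType) (P : pred I) (F : I -> quat R) :
  qre (\sum_(i | P i) F i) = \sum_(i | P i) qre (F i).
Proof. by apply: (big_morph (@qre R)). Qed.

Lemma qmod_ge0 x : 0 <= qmod x.
Proof. exact: sqrtr_ge0. Qed.

Lemma qmod_conj x : qmod (qconj x) = qmod x.
Proof. by rewrite /qmod /= !sqrrN. Qed.

Lemma qmod_sqr x :
  qmod x ^+ 2 = qre x ^+ 2 + qim_i x ^+ 2 + qim_j x ^+ 2 + qim_k x ^+ 2.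
Proof. by rewrite sqr_sqrtr // !addr_ge0 // sqr_ge0. Qed.

(** Euler's four-square identity. *)
Lemma qmodM x y : qmod (x * y) = qmod x * qmod y.
Proof.
apply/eqP; rewrite -(eqrXn2 (n := 2)) ?mulr_ge0 ?qmod_ge0 //.
rewrite exprMn !qmod_sqr; apply/eqP.
by case: x y => [a b c d] [e f g h] /=; ring.
Qed.

Lemma qmod_eq0 x : (qmod x == 0) = (x == 0).
Proof.
apply/idP/eqP => [/eqP h | ->]; last first.
  by rewrite -sqrf_eq0 qmod_sqr /= !expr0n /= !addr0.
have := qmod_sqr x; rewrite h expr0n /=; case: x {h} => a b c d /= h.
have [ha hb hc hd] : [/\ a = 0, b = 0, c = 0 & d = 0].
  by split; apply/eqP; rewrite -sqrf_eq0; apply/eqP; nra.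
by rewrite ha hb hc hd.
Qed.

Lemma qre_le_qmod x : qre x <= qmod x.
Proof.
apply: (le_trans (ler_norm _)).
rewrite -(ler_sqr (x := `|qre x|)) ?nnegrE ?qmod_ge0 // real_normK ?num_real //.
by rewrite qmod_sqr -!addrA lerDl !addr_ge0 // sqr_ge0.
Qed.

(** Cyclic invariance of the real part, together with [conj x * x = |x|^2]. *)
Lemma qre_conjugation x l : qre (x * l * qconj x) = qre l * qmod x ^+ 2.
Proof.
by rewrite qmod_sqr; case: x l => [a b c d] [e f g h] /=; ring.
Qed.

Lemma qre_mul_mul_conj y x : qre (y * x * qconj x) = qre y * qmod x ^+ 2.
Proof.
by rewrite qmod_sqr; case: x y => [a b c d] [e f g h] /=; ring.
Qed.

End Quaternions.

Lemma right_eigenvalue_qre_le (R : realType) (n : nat) (A : 'M[quat R]_n)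
    (l : quat R) :
  right_eigenvalues A l -> exists i, qre l <= qre (A i i) + row_sum A i.
Proof.
case=> x x_neq0 Ax.
have [i0 xi0_neq0] : exists i0, x i0 ord0 != 0.
  apply/existsP; apply: contraNT x_neq0; rewrite negb_exists => /forallP x0.
  apply/eqP/matrixP => i j; rewrite (ord1 j) mxE.
  by apply/eqP; have := x0 i; rewrite negbK.
case: (Order.TotalTheory.arg_maxP (fun i => qmod (x i ord0)) (i0 := i0)
         (P := xpredT)) => // i _ x_max.
have x_gt0 : 0 < qmod (x i ord0).
  apply: lt_le_trans (x_max i0 isT).
  by rewrite lt_def qmod_ge0 qmod_eq0 xi0_neq0.
exists i.
have row_i : qre l * qmod (x i ord0) ^+ 2 =
    qre (A i i) * qmod (x i ord0) ^+ 2
    + \sum_(j < n | j != i) qre (A i j * x j ord0 * qconj (x i ord0)).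
  rewrite -qre_conjugation -qre_mul_mul_conj.
  have := congr1 (fun M : 'cV_n => M i ord0) Ax; rewrite !mxE => <-.
  by rewrite mulr_suml qre_sum (bigD1 i).
rewrite -(ler_pM2r (x := qmod (x i ord0) ^+ 2)) ?exprn_gt0 //.
rewrite row_i mulrDl lerD2l.
rewrite /row_sum mulr_suml; apply: ler_sum => j _.
apply: (le_trans (qre_le_qmod _)); rewrite !qmodM qmod_conj -mulrA.
rewrite ler_wpM2l ?qmod_ge0 // expr2 ler_wpM2r ?qmod_ge0 //; exact: x_max.
Qed.

(** Hölder's inequality against the constant vector 1.  Young's inequality is
    applied to the pairs [(b i / N, u^-1)], where [N] is the [p]-norm of [b] and
    [u] the [q]-norm of the vector 1: after this normalisation the two vectors
    have norm 1, so the right-hand sides add up to [1/p + 1/q = 1]. *)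
Lemma sum_le_card_pnorm (R : realType) (I : finType) (P : pred I) (b : I -> R)
    (p q : R) :
  0 < p -> 0 < q -> p^-1 + q^-1 = 1 -> (forall i, 0 <= b i) ->
  \sum_(i | P i) b i
    <= powR #|P|%:R q^-1 * powR (\sum_(i | P i) powR (b i) p) p^-1.
Proof.
move=> p_gt0 q_gt0 pq b_ge0.
set S := \sum_(i | P i) powR (b i) p; set N := powR S p^-1.
set u := powR #|P|%:R q^-1.
have S_ge0 : 0 <= S by apply: sumr_ge0 => i _; exact: powR_ge0.
have [S0|S_neq0] := eqVneq S 0.
  rewrite big1 ?mulr_ge0 ?powR_ge0 // => i Pi.
  have /eqP := psumr_eq0P (fun i _ => powR_ge0 (b i) p) S0 Pi.
  by rewrite powR_eq0 => /andP[/eqP].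
have S_gt0 : 0 < S by rewrite lt_def S_neq0.
have m_gt0 : 0 < #|P|%:R :> R.
  rewrite ltr0n lt0n; apply: contra S_neq0 => /eqP/card0_eq P0.
  by rewrite /S big_pred0 // => i; have := P0 i; rewrite inE.
have N_gt0 : 0 < N by rewrite powR_gt0.
have u_gt0 : 0 < u by rewrite powR_gt0.
have powNp : powR N p = S by rewrite /N -powRrM mulVf ?gt_eqF // powRr1.
have powuq : powR u q = #|P|%:R by rewrite /u -powRrM mulVf ?gt_eqF // powRr1 ?ltW.
have powV x r : 0 < x -> powR x^-1 r = (powR x r)^-1 :> R.
  by move=> x_gt0; rewrite -[x^-1]powR_inv1 ?ltW // -powRrM mulN1r powRN.
have young i : P i ->
    b i / N * u^-1 <= powR (b i) p / S / p + #|P|%:R^-1 / q.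
  move=> _.
  have bN_ge0 : 0 <= b i / N by rewrite divr_ge0 // ltW.
  have uV_ge0 : 0 <= u^-1 by rewrite invr_ge0 ltW.
  have -> : powR (b i) p / S = powR (b i / N) p.
    by rewrite powRM ?invr_ge0 ?powV ?powNp // ltW.
  by rewrite -powuq -powV //; exact: conjugate_powR.
have := ler_sum (index_enum I) young.
rewrite -!mulr_suml big_split /= -!mulr_suml sumr_const mulfV // mul1r.
rewrite -[_^-1 *+ _]mulr_natl mulfV ?gt_eqF // mul1r pq.
by rewrite -mulrA -invfM ler_pdivrMr ?mulr_gt0 // mul1r mulrC.
Qed.

(** No case [r = 0] has to be excluded: the exponents add up to 1, so the sum
    law for powers holds at 0 too, even with the convention [powR 0 0 = 1]. *)
Lemma powR_interpolate (R : realType) (r g : R) :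
  0 <= r -> powR r g * powR r (1 - g) = r.
Proof.
move=> r_ge0; rewrite -powRD; first by rewrite addrC subrK powRr1.
by rewrite addrC subrK oner_eq0.
Qed.

Lemma row_sum_le_interpolation (R : realType) (n : nat) (A : 'M[quat R]_n)
    (gamma p q : R) (i : 'I_n) :
  gamma <= 1 -> 0 < p -> 0 < q -> p^-1 + q^-1 = 1 ->
  row_sum A i <= powR (n%:R - 1) ((1 - gamma) / q) * powR (row_sum A i) gamma
                 * powR (row_pnorm p A i) (1 - gamma).
Proof.
move=> gamma1 p_gt0 q_gt0 pq.
have r_ge0 : 0 <= row_sum A i by apply: sumr_ge0 => j _; exact: qmod_ge0.
have n_ge1 : (1 <= n)%N by exact: leq_ltn_trans (ltn_ord i).
have := @sum_le_card_pnorm R _ (predC1 i) (fun j => qmod (A i j)) p q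
          p_gt0 q_gt0 pq (fun j => qmod_ge0 _).
rewrite cardC1 card_ord -subn1 natrB // => holder.
rewrite -[leLHS](@powR_interpolate _ _ gamma) // mulrAC mulrC.
rewrite [(1 - gamma) / q]mulrC powRrM -powRM ?powR_ge0 //.
rewrite ler_wpM2r ?powR_ge0 //; apply: ge0_ler_powR; rewrite ?subr_ge0 //.
by rewrite nnegrE mulr_ge0 ?powR_ge0.
Qed.

(* [powR 0 0 = 1]. *)
Theorem proposition3p17 (R : realType) (n : nat) (A : 'M[quat R]_n)
    (gamma p q : R) (hgamma0 : 0 <= gamma) (hgamma1 : gamma <= 1)
    (hp : 1 < p) (hq : 1 < q) (hpq : 1 / p + 1 / q = 1)
    (hA : forall i : 'I_n,
        qre (A i i)
        + powR (n%:R - 1) ((1 - gamma) / q) * powR (row_sum A i) gamma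
          * powR (row_pnorm p A i) (1 - gamma) < 0) :
  quat_stable A.
Proof.
move=> l /right_eigenvalue_qre_le[i l_le] /=.
apply: (le_lt_trans l_le); apply: le_lt_trans (hA i); rewrite lerD2l.
have [p_gt0 q_gt0] : 0 < p /\ 0 < q by split; exact: lt_trans ltr01 _.
by apply: row_sum_le_interpolation => //; rewrite -hpq !div1r.
Qed.
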